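(* For each $n$ let $\mathbf{w}=(w_1,\ldots,w_n)\in\mathbb{R}_+^n$ be a collection of vertex weights satisfying $\max_{i\in[n]}w_i\le\sqrt{\sum_{i\in[n]}w_i}$ and let $s\in[0,1]$ (both possibly depending on $n$). Let $(G_1,G_2)$ be a pair of correlated Chung-Lu graphs with parameters $(\mathbf{w},s)$ and latent permutation $\pi_*$. Suppose that $$\max_{i\in[n]}w_i\le n^{-\alpha/2+o(1)}\sqrt{\sum_{i=1}^n w_i}$$ for some constant $\alpha\in(1/2,1]$, and let $k>12/(2\alpha-1)$ be a constant positive integer. Furthermore, suppose that there exists a constant $\epsilon>0$ such that $$\min_{i\in[n]}w_is^2\ge(1+\epsilon)\log n .$$ Let $(\widehat M_k,\widehat\mu_k)$ be the $k$-core estimator of $(G_1,G_2)$. Then $\mathbb{P}(\widehat\mu_k=\pi_* )=1-o(1)$ as $n\to\infty$ (where $\widehat\mu_k=\pi_*$ means $\widehat M_k=[n]$ and $\widehat\mu_k(i)=\pi_*(i)$ for all $i$).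
   Context: Correlated Chung-Lu graphs with parameters $(\mathbf{w},s)$: generate a simple undirected random graph $G$ on $[n]$ in which each edge $\{i,j\}$, $i\ne j$, is present with probability $p_{ij}=w_iw_j/(\sum_{k\in[n]}w_k)$, independently over unordered pairs; conditionally on $G$, generate $G_1$ and $G_2'$ independently, each keeping every edge of $G$ independently with probability $s$ (same vertex set $[n]$); finally let $\pi_*$ be an independent uniformly random permutation of $[n]$ and let $G_2$ be $G_2'$ with vertices relabelled by $\pi_*$, so that $\{\pi_*(i),\pi_*(j)\}$ is an edge of $G_2$ iff $\{i,j\}$ is an edge of $G_2'$. A matching is a pair $(M,\mu)$ with $M\subseteq[n]$ and $\mu:M\to[n]$ injective. $G_1\wedge_\mu G_2$ is the graph on vertex set $M$ in which $\{i,j\}$ is an edge iff $\{i,j\}$ is an edge of $G_1$ and $\{\mu(i),\mu(j)\}$ is an edge of $G_2$. A matching is a $k$-core matching if every vertex of $G_1\wedge_\mu G_2$ has degree at least $k$ (the empty matching qualifies vacuously). The $k$-core estimator $(\widehat M_k,\widehat\mu_k)$ is a $k$-core matching of $(G_1,G_2)$ with $|M|$ as large as possible among all $k$-core matchings (ties broken arbitrarily). $n^{-\alpha/2+o(1)}$ stands for $n^{-\alpha/2+\varepsilon_n}$ for some deterministic sequence $\varepsilon_n\to0$. *)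

(* Defs.v *)
From HB Require Import structures.
From mathcomp Require Import all_boot all_order all_algebra all_fingroup.
From mathcomp Require Import all_classical all_reals all_analysis.

Set Implicit Arguments.
Unset Strict Implicit.
Unset Printing Implicit Defensive.

Import Order.TTheory GRing.Theory Num.Theory.
Local Open Scope ring_scope.

Section Graphs.
Variable n : nat.

Definition edge : finType := {e : {set 'I_n} | #|e| == 2}.

(* An arbitrary set of 2-element subsets is exactly a simple undirected graph
   on 'I_n. *)
Definition graph : finType := {set edge}.

Definition adj (G : graph) (i j : 'I_n) : bool :=
  [exists e in G, val e == [set i; j]%SET].

Definition relabel (pi : {perm 'I_n}) (G : graph) : graph :=
  [set f : edge | [exists e in G, val f == [set pi i | i in val e]%SET]]%SET.

(* A pair (M, mu) with mu : M -> [n]; [mm m] is total but its values outside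
   [mdom m] are junk. *)
Record matching : Type := Matching {
  mdom : {set 'I_n};
  mm : 'I_n -> 'I_n;
  mm_inj : {in mdom &, injective mm} }.

Definition meet_adj (G1 G2 : graph) (m : matching) (i j : 'I_n) : bool :=
  [&& i \in mdom m, j \in mdom m, adj G1 i j & adj G2 (mm m i) (mm m j)].

Definition meet_deg (G1 G2 : graph) (m : matching) (i : 'I_n) : nat :=
  #|[set j | meet_adj G1 G2 m i j]%SET|.

Definition kcore_matching (k : nat) (G1 G2 : graph) (m : matching) : Prop :=
  forall i, i \in mdom m -> (k <= meet_deg G1 G2 m i)%N.

(* Any function of the observed pair of graphs selecting a maximiser: no
   tie-breaking rule is imposed. *)
Definition kcore_estimator (k : nat) (est : graph -> graph -> matching) : Prop :=
  forall G1 G2,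
    kcore_matching k G1 G2 (est G1 G2) /\
    (forall m, kcore_matching k G1 G2 m -> (#|mdom m| <= #|mdom (est G1 G2)|)%N).

Definition matching_eq_perm (m : matching) (pi : {perm 'I_n}) : bool :=
  (mdom m == [set: 'I_n]%SET) && [forall i, mm m i == pi i].

End Graphs.

Section Model.
Variables (R : realType) (n : nat).

(* Law of the random graph whose edges e are present independently with
   probabilities q e. *)
Definition indep_edges_pmf (q : edge n -> R) (G : graph n) : R :=
  \prod_(e : edge n) bernoulli_pmf (q e) (e \in G).

Definition chung_lu_edge_prob (w : 'I_n -> R) (e : edge n) : R :=
  (\prod_(i in val e) w i) / \sum_k w k.

Definition subsample_pmf (s : R) (G : graph n) : graph n -> R :=
  indep_edges_pmf (fun e => if e \in G then s else 0).

(* Tuples (G, G1, G2', pi), where pi is the latent permutation. *)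
Definition outcome : finType :=
  (graph n * graph n * graph n * {perm 'I_n})%type.

Definition corr_CL_pmf (w : 'I_n -> R) (s : R) (x : outcome) : R :=
  let: (G, G1, G2', _) := x in
  indep_edges_pmf (chung_lu_edge_prob w) G
  * subsample_pmf s G G1 * subsample_pmf s G G2'
  * #|{perm 'I_n}|%:R^-1.

Definition corr_CL_prob (w : 'I_n -> R) (s : R) (A : pred outcome) : R :=
  \sum_(x | A x) corr_CL_pmf w s x.

(* The estimator sees G1 and G2 = relabel pi G2' only. *)
Definition exact_recovery (est : graph n -> graph n -> matching n) :
    pred outcome :=
  fun x => let: (_, G1, G2', pi) := x in
    matching_eq_perm (est G1 (relabel pi G2')) pi.

End Model.

(* Main.v *)
Require Import Defs.
From HB Require Import structures.
From mathcomp Require Import all_boot all_order all_algebra all_fingroup.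
From mathcomp Require Import all_classical all_reals all_analysis.
From mathcomp Require Import zify ring lra.
Import Order.TTheory GRing.Theory Num.Theory.
Import numFieldNormedType.Exports.

(** Write [G1] and [G2'] for the two subsamples before relabelling, [W] for the total
    weight and [p] for the largest edge probability, which is at most
    [n^(-alpha + o(1))].

    If every vertex has degree at least [k] in the intersection of [G1] and [G2'],
    then the true matching is a k-core matching on all [n] vertices. A largest
    k-core matching is then a permutation too, say the latent one after some
    [sigma], and the estimator errs only if some [sigma] other than the identity
    leaves all degrees at least [k] in the graph of the edges [e] of [G1] such that
    [sigma e] is an edge of [G2'] ([kcore_estimator_exact]). So there are two
    kinds of bad event, controlled by a union bound
    ([exact_recovery_prob_ge]).

    Low degree. The degree of [i] in the intersection is a sum of independent
    indicators of mean at least [(w i - 1) s^2], because [w i ^ 2 <= W]. Chernoff's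
    bound ([tilt_mean_le]) and the assumption on [w i * s^2] give a probability of
    order [n^(-1 - eps/2)] for each vertex.

    Wrong permutation. Let [sigma] displace [d >= 1] points. The degrees at these
    points force at least [(k - 1) d / 2] edges of [G1] moved by [sigma], with image
    in [G2']. A third of them forms a set [S] disjoint from its image
    ([kcore_witness]), so that [2 #|S|] distinct edges of the parent graph are
    present, at a price of [p^(2 #|S|)]. There are at most [d n] edges to choose
    [S] from, and summing over all [S] gives at most
    [e^d (n p^2)^((k - 1) d / 6)] ([sum_witness_le]). Since [n p^2] is
    [n^(1 - 2 alpha + o(1))] and [k (2 alpha - 1) > 12], this is below
    [e^d n^(- 3 d / 2)], while at most [n^d] permutations displace exactly [d]
    points ([sum_displaced_le]). The sum over [d] is a geometric series of order
    [n^(-1/2)].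

    Both estimates rest on one product formula for the means of functions that
    factor over the edges ([corr_CL_mean_edgewise]). *)

Set Implicit Arguments.
Unset Strict Implicit.
Local Open Scope ring_scope.

(** * General facts on finite sets and sums *)

(** In the graph joining each [x] to [f x], a maximal independent subset [B] of
    [A] meets the closed neighbourhood of every point of [A], so that
    [A] is covered by [B], its image and its preimage. *)
Lemma independent_subset (T : finType) (f : T -> T) (A : {set T}) :
  injective f -> (forall x, x \in A -> f x != x) ->
  exists B : {set T}, [/\ B \subset A, [disjoint B & f @: B]%SET &
    (#|A| <= 3 * #|B|)%N].
Proof.
move=> finj fA.
pose P (B : {set T}) := (B \subset A) && [disjoint B & f @: B]%SET.
have P0 : P finset.set0.
  by rewrite /P finset.sub0set imset0 -setI_eq0 finset.setI0 eqxx.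
have [S] := ex_maxset (ex_intro P _ P0).
case/maxsetP => /andP[SA Sf] Smax; exists S; split=> //.
have sub : A \subset (S :|: (f @: S :|: f @^-1: S))%SET.
  apply/fintype.subsetP => a aA; rewrite !inE; apply/negPn/negP.
  rewrite !negb_or => /and3P[aS afS faS].
  suff /Smax aSE : P (a |: S)%SET by rewrite -aSE ?finset.subsetUr// setU11 in aS.
  rewrite /P finset.subUset finset.sub1set aA SA imsetU1 /=.
  rewrite disjoint_subset; apply/fintype.subsetP => x; rewrite !inE negb_or.
  case/orP => [/eqP->|xS]; first by rewrite eq_sym fA.
  by rewrite (contraNneq _ faS) => [|<-]; rewrite ?(disjointFr Sf).
apply: (leq_trans (subset_leq_card sub)).
apply: (leq_trans (leq_card_setU _ _)).
rewrite (_ : 3 * #|S| = #|S| + (#|S| + #|S|))%N; last by lia.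
rewrite leq_add2l (leq_trans (leq_card_setU _ _))//.
by rewrite card_imset// card_preimset.
Qed.

(** Independence of the edges of a random graph, in disguise: summing a product
    weight over all edge sets factors over the edges. *)
Lemma sum_set_prod (R : comPzSemiRingType) (T : finType) (F : T -> bool -> R) :
  \sum_(A : {set T}) \prod_x F x (x \in A) = \prod_x \sum_(b : bool) F x b.
Proof.
under [RHS]eq_bigr do rewrite big_bool.
rewrite bigA_distr; apply: eq_bigr => A _; apply: eq_bigr => x _.
by case: (x \in A).
Qed.

Lemma ffact_le m d : (m ^_ d <= m ^ d)%N.
Proof.
elim: d m => [|d IH] [|m]; rewrite ?ffactn0 ?expn0 ?ffact0n// ffactSS expnS.
rewrite leq_mul2l (leq_trans (IH m))//.
by case: d {IH} => // d; rewrite leq_exp2r.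
Qed.

Lemma sum_geometric_le (R : realType) (z : R) m : 0 <= z <= 1 / 2 ->
  \sum_(d < m) z ^+ d.+1 <= 2 * z.
Proof.
move=> /andP[z0 z12].
under eq_bigr do rewrite exprS.
rewrite -mulr_sumr mulrC ler_wpM2r//.
have zm : 0 <= z ^+ m by rewrite exprn_ge0.
have := subrX1 z m; set Z := \sum_(_ < _) _ => ZE.
have Z0 : 0 <= Z by apply: sumr_ge0 => i _; rewrite exprn_ge0.
by nra.
Qed.

(** * Edge permutations and k-core matchings *)

Section Combinatorics.
Variable n : nat.
Implicit Types (i j : 'I_n) (e : edge n) (G H S : {set edge n}).
Implicit Types (sigma pi : {perm 'I_n}).

Definition Edge (A : {set 'I_n}) (A2 : #|A| == 2) : edge n :=
  exist (fun B : {set 'I_n} => #|B| == 2) A A2.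

(** This and the next lemma turn a sum over the edges at [i] into a sum over the
    other endpoint; vertex degrees, which are defined by neighbours, and the
    model, which is defined by edges, are compared through them. *)
Lemma incident_edgesE i :
  ([set val e | e in [set e : edge n | i \in val e]] =
   [set [set i; j] | j in [set~ i]])%SET.
Proof.
apply/setP => A; apply/imsetP/imsetP => [[e]|[j]].
  rewrite inE => ie ->.
  have [x [y [xy eE]]] : exists x y, x != y /\ val e = [set x; y]%SET.
    exact/cards2P/(valP e).
  move: ie; rewrite eE !inE => /orP[/eqP->|/eqP->].
    by exists y => //; rewrite !inE eq_sym.
  by exists x; [rewrite !inE|rewrite finset.setUC].
rewrite !inE eq_sym => ij ->.
have ijP : #|[set i; j]%SET| == 2 by rewrite cards2 ij.
by exists (Edge ijP); rewrite // inE /= !inE eqxx.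
Qed.

Lemma big_incident (T : Type) (idx : T) (op : Monoid.com_law idx)
    (F : {set 'I_n} -> T) i :
  \big[op/idx]_(e : edge n | i \in val e) F (val e) =
  \big[op/idx]_(j | j != i) F [set i; j]%SET.
Proof.
transitivity (\big[op/idx]_(A in
    [set val e | e in [set e : edge n | i \in val e]]%SET) F A).
  rewrite big_imset /=; last by move=> x y _ _; exact: val_inj.
  by apply: eq_bigl => e; rewrite inE.
rewrite incident_edgesE big_imset /=.
  by apply: eq_bigl => e; rewrite !inE.
move=> x y; rewrite !inE => xi yi /setP /(_ x).
by rewrite !inE eqxx orbT (negbTE xi) /= => /esym/eqP.
Qed.

Definition edge_degree H i : nat := #|[set e in H | i \in val e]%SET|.

Lemma edge_degreeE H i :
  edge_degree H i = #|[set j | [exists e in H, val e == [set i; j]]]%SET|.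
Proof.
have inH (e : edge n) : (e \in H) = [exists e' in H, val e' == val e].
  apply/idP/existsP => [eH|[e' /andP[e'H /eqP/val_inj<-//]]].
  by exists e; rewrite eH /=.
rewrite /edge_degree -!sum1dep_card big_mkcond [RHS]big_mkcond.
transitivity (\sum_(e : edge n | i \in val e)
    if [exists e' in H, val e' == val e] then 1 else 0)%N.
  rewrite [RHS]big_mkcond; apply: eq_bigr => e _; rewrite -inH.
  by case: (e \in H); case: (i \in val e).
rewrite (big_incident _ (fun A => if [exists e' in H, val e' == A] then 1 else 0)%N).
rewrite /= [LHS]big_mkcond; apply: eq_bigr => j _.
case: eqP => [->|//]; case: existsP => // -[e /andP[_ /eqP eE]].
by have := valP e; rewrite /= eE finset.setUid cards1.
Qed.

Lemma card_edge e : #|val e| = 2%N.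
Proof. exact/eqP/(valP e). Qed.

Lemma edge_perm_subproof sigma e : #|[set sigma x | x in val e]%SET| == 2.
Proof. by rewrite card_imset ?card_edge//; exact: perm_inj. Qed.

Definition edge_perm sigma e : edge n :=
  Edge (edge_perm_subproof sigma e).

Lemma edge_perm_inj sigma : injective (edge_perm sigma).
Proof.
by move=> e f /(congr1 val) /= /(imset_inj perm_inj) /val_inj.
Qed.

Lemma edge_perm1 e : edge_perm 1 e = e.
Proof.
apply: val_inj => /=; under eq_imset do rewrite perm1.
by rewrite imset_id.
Qed.

Lemma adj_relabel pi G i j : adj (relabel pi G) (pi i) (pi j) = adj G i j.
Proof.
have piE : [set pi i; pi j]%SET = [set pi x | x in [set i; j]]%SET.
  by rewrite imsetU1 imset_set1.
apply/existsP/existsP => -[e /andP[eG /eqP eE]].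
  move: eG; rewrite inE => /existsP[f /andP[fG /eqP fE]].
  exists f; rewrite fG /=; apply/eqP/(imset_inj (@perm_inj _ pi)).
  by rewrite -fE -piE.
exists (edge_perm pi e); rewrite inE /= piE eE eqxx andbT.
by apply/existsP; exists e; rewrite eG /= eE.
Qed.

(** If a matching is [pi] after [sigma], these are the edges of the first graph
    that it sends to edges of the second one, read through the true relabelling
    [pi]: edges that survive in the intersection graph. *)
Definition agree sigma (G1 G2 : graph n) : {set edge n} :=
  [set e in G1 | edge_perm sigma e \in G2]%SET.

Lemma adj_agree sigma (G1 G2 : graph n) i j :
  adj G1 i j && adj G2 (sigma i) (sigma j) =
  [exists e in agree sigma G1 G2, val e == [set i; j]%SET].
Proof.
have sE : [set sigma i; sigma j]%SET = [set sigma x | x in [set i; j]]%SET.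
  by rewrite imsetU1 imset_set1.
apply/andP/existsP => [[/existsP[e /andP[eG /eqP eE]] /existsP[f /andP[fG /eqP fE]]]|].
  exists e; rewrite inE eG eE eqxx andbT /=.
  suff -> : edge_perm sigma e = f by [].
  by apply: val_inj; rewrite /= fE sE eE.
move=> [e]; rewrite inE => /andP[/andP[e1 e2] /eqP eE]; split.
  by apply/existsP; exists e; rewrite e1 eE /=.
by apply/existsP; exists (edge_perm sigma e); rewrite e2 /= eE sE.
Qed.

(** The first degree hypothesis makes [pi] itself a k-core matching, defined on all
    vertices. A maximiser is then also defined on all vertices, hence is a
    permutation, and it differs from [pi] by some [sigma] which the second
    hypothesis excludes unless [sigma] is the identity. *)
Lemma kcore_estimator_exact k (est : graph n -> graph n -> matching n)
    (G1 G2 : graph n) pi :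
  kcore_estimator k est ->
  (forall i, (k <= edge_degree (agree 1 G1 G2) i)%N) ->
  (forall sigma, sigma != 1%g ->
    exists i, (edge_degree (agree sigma G1 G2) i < k)%N) ->
  matching_eq_perm (est G1 (relabel pi G2)) pi.
Proof.
move=> /(_ G1 (relabel pi G2)) [core max] deg nocore.
set m := est _ _ in core max *.
pose m0 := @Matching n [set: 'I_n] pi (in2W (@perm_inj _ pi)).
have m0core : kcore_matching k G1 (relabel pi G2) m0.
  move=> i _; have := deg i; rewrite edge_degreeE /meet_deg.
  congr (_ <= _)%N; apply: eq_card => j.
  by rewrite !inE -adj_agree !perm1 /meet_adj /= !inE adj_relabel.
have mT : mdom m = [set: 'I_n]%SET.
  apply/eqP; rewrite eqEcard finset.subsetT /=.
  exact: (max _ m0core).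
have minj : injective (mm m).
  by move=> x y; apply: (mm_inj (m := m)); rewrite mT inE.
pose sigma := (perm minj * pi^-1)%g.
have mmE i : mm m i = pi (sigma i) by rewrite permM permKV permE.
have [/eqP s1|/nocore[i]] := boolP (sigma == 1%g).
  rewrite /matching_eq_perm mT eqxx; apply/forallP => i.
  by rewrite mmE s1 perm1.
rewrite ltnNge => /negP; case.
have /core : i \in mdom m by rewrite mT inE.
rewrite edge_degreeE /meet_deg.
congr (_ <= _)%N; apply: eq_card => j.
by rewrite !inE -adj_agree /meet_adj mT !inE !mmE adj_relabel.
Qed.

Definition displaced sigma : {set 'I_n} := [set i | sigma i != i]%SET.

Definition touching (D : {set 'I_n}) : {set edge n} :=
  [set e : edge n | [exists i in D, i \in val e]]%SET.

Lemma edge_degree_le H i : (edge_degree H i <= n)%N.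
Proof.
by rewrite edge_degreeE (leq_trans (max_card _))// card_ord.
Qed.

Lemma card_touching D : (#|touching D| <= #|D| * n)%N.
Proof.
have sub : touching D \subset
    \bigcup_(i in D) [set e in [set: edge n] | i \in val e]%SET.
  apply/fintype.subsetP => e; rewrite inE => /existsP[i /andP[iD ie]].
  by apply/bigcupP; exists i; rewrite // !inE.
apply: (leq_trans (subset_leq_card sub)).
apply: (@leq_trans (\sum_(i in D) edge_degree [set: edge n]%SET i)).
  elim/big_ind2: _ => [|A a B b Aa Bb|//]; first by rewrite cards0.
  by rewrite (leq_trans (leq_card_setU _ _))// leq_add.
rewrite -sum_nat_const; apply: leq_sum => i _; exact: edge_degree_le.
Qed.

Lemma sum_edge_degree (D : {set 'I_n}) H :
  (\sum_(i in D) edge_degree H i <= 2 * #|H|)%N.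
Proof.
rewrite /edge_degree.
under eq_bigr do rewrite -sum1dep_card big_mkcondr /=.
rewrite exchange_big /= mulnC -sum_nat_const; apply: leq_sum => e _.
rewrite -big_mkcondr sum1dep_card.
apply: (@leq_trans #|val e|); last by rewrite card_edge.
by apply: subset_leq_card; apply/fintype.subsetP => i; rewrite !inE => /andP[].
Qed.

Definition moved_agree sigma (G1 G2 : graph n) : {set edge n} :=
  [set e in agree sigma G1 G2 |
    (e \in touching (displaced sigma)) && (edge_perm sigma e != e)]%SET.

(** Each displaced vertex lies on at most one edge fixed by [sigma], so at least
    [k - 1] of its edges are moved, and an edge is counted at most twice. Edges
    fixed by [sigma] have to be set aside because their presence costs only a
    single factor of the edge probability. *)
Lemma card_moved_agree k sigma (G1 G2 : graph n) :
  (forall i, (k <= edge_degree (agree sigma G1 G2) i)%N) ->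
  (k.-1 * #|displaced sigma| <= 2 * #|moved_agree sigma G1 G2|)%N.
Proof.
move=> deg; apply: leq_trans (sum_edge_degree (displaced sigma) _).
rewrite mulnC -sum_nat_const; apply: leq_sum => i.
rewrite inE => si; have := deg i; case: k {deg} => // k /= kd.
rewrite -ltnS (leq_trans kd)// -add1n.
set A := agree _ _ _.
rewrite /edge_degree -(cardsID [set e | edge_perm sigma e == e]%SET) leq_add//.
  (* A fixed edge at a displaced vertex [i] must be [{i, sigma i}]. *)
  apply: (@leq_trans #|[set [set i; sigma i]%SET]%SET|); last by rewrite cards1.
  rewrite -(card_imset _ (@val_inj _ _ (edge n))).
  apply: subset_leq_card; apply/fintype.subsetP => B /imsetP[e].
  rewrite !inE => /andP[/andP[_ ie] /eqP /(congr1 val) /= fe] ->.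
  rewrite eq_sym eqEcard cards2 eq_sym si card_edge leqnn andbT.
  apply/fintype.subsetP => x; rewrite !inE => /orP[/eqP->//|/eqP->].
  by rewrite -fe imset_f.
apply: subset_leq_card; apply/fintype.subsetP => e; rewrite !inE.
move=> /andP[-> /andP[-> ie]]; rewrite ie !andbT /=.
by apply/existsP; exists i; rewrite inE si.
Qed.

(** What a wrong permutation has to exhibit. The events that [e] is in [G1] and
    [edge_perm sigma e] is in [G2] are correlated along the cycles of [sigma];
    passing to an independent third of the moved edges makes [S] and its image
    disjoint, so that [2 * #|S|] distinct edges of the parent graph are
    present. *)
Lemma kcore_witness k sigma (G1 G2 : graph n) :
  (forall i, (k <= edge_degree (agree sigma G1 G2) i)%N) ->
  exists S : {set edge n},
    [/\ S \subset touching (displaced sigma),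
        (k.-1 * #|displaced sigma| <= 6 * #|S|)%N,
        [disjoint S & edge_perm sigma @: S]%SET,
        S \subset G1 & (edge_perm sigma @: S)%SET \subset G2].
Proof.
move=> /card_moved_agree card_le.
have [||S [SA dis cS]] :=
  @independent_subset _ (edge_perm sigma) (moved_agree sigma G1 G2).
- exact: edge_perm_inj.
- by move=> e; rewrite inE => /andP[_ /andP[]].
exists S; split=> //.
- by apply/fintype.subsetP => e /(fintype.subsetP SA); rewrite inE => /andP[_ /andP[]].
- by lia.
- by apply/fintype.subsetP => e /(fintype.subsetP SA); rewrite !inE => /andP[/andP[]].
- apply/fintype.subsetP => f /imsetP[e /(fintype.subsetP SA)]; rewrite !inE.
  by move=> /andP[/andP[_ eG] _ ->].
Qed.

End Combinatorics.

(** * Means in the correlated Chung-Lu model *)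

Section Expectation.
Variables (R : realType) (n : nat).

(** Mean of [g] at the indicators of one edge in the parent graph and in its two
    subsamples. *)
Definition edge_mean (p s : R) (g : bool -> bool -> bool -> R) : R :=
  \sum_(b : bool) bernoulli_pmf p b *
  \sum_(b1 : bool) bernoulli_pmf (if b then s else 0) b1 *
  \sum_(b2 : bool) bernoulli_pmf (if b then s else 0) b2 * g b b1 b2.

Definition edgewise (g : edge n -> bool -> bool -> bool -> R)
    (x : outcome n) : R :=
  let: (G, G1, G2, _) := x in
  \prod_e g e (e \in G) (e \in G1) (e \in G2).

Lemma corr_CL_mean_edgewise (w : 'I_n -> R) s g :
  \sum_x corr_CL_pmf w s x * edgewise g x =
  \prod_e edge_mean (chung_lu_edge_prob w e) s (g e).
Proof.
transitivity (\sum_(G : graph n) \sum_(G1 : graph n) \sum_(G2 : graph n)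
    \sum_(pi : {perm 'I_n})
      corr_CL_pmf w s (G, G1, G2, pi) * edgewise g (G, G1, G2, pi)).
  rewrite pair_bigA /= pair_bigA /= pair_bigA /=.
  by apply: eq_bigr => -[[[]]].
rewrite /edgewise /edge_mean -sum_set_prod; apply: eq_bigr => G _.
rewrite big_split /= -sum_set_prod mulr_sumr; apply: eq_bigr => G1 _.
rewrite big_split /= -sum_set_prod mulrA mulr_sumr; apply: eq_bigr => G2 _.
rewrite big_split /= sumr_const -mulr_natr.
have N0 : #|{perm 'I_n}|%:R != 0 :> R.
  by rewrite pnatr_eq0 -lt0n; apply/card_gt0P; exists 1%g.
rewrite /subsample_pmf /indep_edges_pmf.
by field.
Qed.

Variables (w : 'I_n -> R) (s : R).
Hypothesis w0 : forall i, 0 <= w i.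
Hypothesis wW : forall i, w i <= Num.sqrt (\sum_j w j).
Hypothesis s01 : 0 <= s <= 1.

Let q := chung_lu_edge_prob w.
Let W : R := \sum_j w j.

Let W0 : 0 <= W. Proof. exact: sumr_ge0. Qed.

(** Stated with a general constant [c] since it serves twice: [c = 1] says that
    the edge weights are probabilities, and [c] close to [n `^ (- alpha / 2)]
    gives the sparsity that defeats the wrong permutations. *)
Lemma edge_prob_le c : (forall i, w i <= c * Num.sqrt W) ->
  forall e, q e <= c ^+ 2.
Proof.
move=> wc e; have [i [j [ij eE]]] : exists i j, i != j /\ val e = [set i; j]%SET.
  exact/cards2P/(valP e).
have -> : q e = w i * w j / W.
  by rewrite /q /chung_lu_edge_prob eE big_setU1 ?inE//= big_set1.
have [W_eq0|Wn] := eqVneq W 0; first by rewrite W_eq0 invr0 mulr0 sqr_ge0.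
rewrite ler_pdivrMr ?lt0r ?Wn// -[X in _ <= _ * X]sqr_sqrtr// -exprMn expr2.
by rewrite ler_pM.
Qed.

Lemma edge_prob01 e : 0 <= q e <= 1.
Proof.
rewrite divr_ge0 ?prodr_ge0//= -[leRHS](expr1n _ 2); apply: edge_prob_le => i.
by rewrite mul1r wW.
Qed.

Lemma corr_CL_pmf_ge0 x : 0 <= corr_CL_pmf w s x.
Proof.
case: x => -[[G G1] G2] pi; rewrite /corr_CL_pmf.
have sub e : 0 <= (if e \in G then s else 0) <= 1.
  by case: ifP => // _; rewrite lexx ler01.
rewrite !mulr_ge0 ?invr_ge0// prodr_ge0// => e _;
  by rewrite bernoulli_pmf_ge0// edge_prob01.
Qed.

Lemma sum_corr_CL_pmf : \sum_x corr_CL_pmf w s x = 1.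
Proof.
transitivity (\sum_x corr_CL_pmf w s x * edgewise (fun _ _ _ _ => 1) x).
  by apply: eq_bigr => -[[[G G1] G2] pi] _; rewrite /edgewise big1// mulr1.
rewrite corr_CL_mean_edgewise big1// => e _.
by rewrite /edge_mean !big_bool /=; ring.
Qed.

(** Markov's inequality for the failure of [A], with [X] dominating the indicator of
    failure. *)
Lemma corr_CL_prob_le (A : pred (outcome n)) (X : outcome n -> R) :
  (forall x, 0 <= X x) -> (forall x, ~~ A x -> 1 <= X x) ->
  1 - \sum_x corr_CL_pmf w s x * X x <= corr_CL_prob w s A <= 1.
Proof.
move=> X0 X1; rewrite /corr_CL_prob; apply/andP; split; last first.
  rewrite -[leRHS]sum_corr_CL_pmf big_mkcond; apply: ler_sum => x _.
  by case: ifP => // _; exact: corr_CL_pmf_ge0.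
rewrite -[X in X - _]sum_corr_CL_pmf -sumrB [leRHS]big_mkcond.
apply: ler_sum => x _; have p0 := corr_CL_pmf_ge0 x.
case: ifPn => Ax; first by rewrite gerBl mulr_ge0.
by rewrite subr_le0 ler_peMr// X1.
Qed.

(** Exponential tilt for the degree of [i] in the intersection of the two
    subsamples. *)
Definition tilt (t : R) (i : 'I_n) (e : edge n) (_ b1 b2 : bool) : R :=
  if [&& i \in val e, b1 & b2] then t else 1.

Lemma edgewise_tilt t i (G G1 G2 : graph n) pi :
  edgewise (tilt t i) (G, G1, G2, pi) = t ^+ edge_degree (agree 1 G1 G2) i.
Proof.
rewrite /edgewise /tilt -big_mkcond /= prodr_const; congr (_ ^+ _).
apply: eq_card => e; rewrite !inE unfold_in /= edge_perm1.
by rewrite andbC.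
Qed.

(** Letting the second endpoint range over all vertices, [i] included, would give
    [w i]; the diagonal term [w i ^+ 2 / W] is at most [1]. *)
Lemma sum_edge_prob_incident i :
  w i - 1 <= \sum_(e : edge n | i \in val e) q e.
Proof.
have -> : \sum_(e : edge n | i \in val e) q e = w i * (W - w i) / W.
  rewrite (big_incident _ (fun A => (\prod_(l in A) w l) / W) i) /=.
  have -> : W - w i = \sum_(j | j != i) w j.
    by rewrite /W (bigD1 i)//= addrAC subrr add0r.
  rewrite -mulr_suml mulr_sumr.
  congr (_ / _); apply: eq_bigr => j ji.
  by rewrite big_setU1 ?inE 1?eq_sym//= big_set1.
have wi2 : w i ^+ 2 <= W.
  rewrite -[leRHS]sqr_sqrtr//.
  by rewrite ler_sqr ?nnegrE ?sqrtr_ge0.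
have [W_eq0|Wn] := eqVneq W 0.
  by move: wi2; rewrite W_eq0 invr0 mulr0 subr_le0; nra.
have Wp : 0 < W by rewrite lt0r Wn W0.
by rewrite ler_pdivlMr//; nra.
Qed.

(** Each edge at [i] contributes [1 - (1 - t) * s ^+ 2 * q e], which is bounded by
    an exponential as in Chernoff's bound. *)
Lemma tilt_mean_le (t : R) i : 0 <= t <= 1 ->
  \sum_x corr_CL_pmf w s x * edgewise (tilt t i) x <=
  expR (1 - (1 - t) * (w i * s ^+ 2)).
Proof.
move=> t01; rewrite corr_CL_mean_edgewise.
have [t0 t1] := andP t01; have [s0 s1] := andP s01.
have s21 : s ^+ 2 <= 1 by rewrite expr_le1.
have s20 : 0 <= s ^+ 2 by rewrite sqr_ge0.
have u0 : 0 <= (1 - t) * s ^+ 2 by rewrite mulr_ge0// subr_ge0.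
have u1 : (1 - t) * s ^+ 2 <= 1 by rewrite mulr_ile1// ?subr_ge0//; lra.
apply: (@le_trans _ _ (\prod_(e : edge n | i \in val e)
    expR (- (1 - t) * s ^+ 2 * q e))).
  rewrite [leRHS]big_mkcond; apply: ler_prod => e _; rewrite /edge_mean /tilt.
  have /andP[q0 q1] := edge_prob01 e.
  rewrite !big_bool /=; case: (i \in val e) => /=; last first.
    rewrite -/(q e); apply/andP; split.
      rewrite [leRHS](_ : _ = 1) ?ler01//; ring.
    rewrite [leLHS](_ : _ = 1) ?lexx//; ring.
  rewrite -/(q e) [X in _ <= X <= _](_ : _ = 1 + - (1 - t) * s ^+ 2 * q e); last by ring.
  rewrite expR_ge1Dx andbT mulNr mulNr subr_ge0 -/(q e) mulr_ile1 //.
rewrite -expR_sum ler_expR -mulr_sumr.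
have := sum_edge_prob_incident i; set Q := \sum_(_ | _) _ => wQ.
have : (1 - t) * s ^+ 2 * (w i - 1) <= (1 - t) * s ^+ 2 * Q.
  by rewrite ler_wpM2l.
lra.
Qed.

Definition pattern (S1 S2 : {set edge n}) (e : edge n) (_ b1 b2 : bool) : R :=
  ((e \in S1) ==> b1)%:R * ((e \in S2) ==> b2)%:R.

Lemma edgewise_pattern (S1 S2 : {set edge n}) (G G1 G2 : graph n) pi :
  S1 \subset G1 -> S2 \subset G2 ->
  edgewise (pattern S1 S2) (G, G1, G2, pi) = 1.
Proof.
move=> /fintype.subsetP SG1 /fintype.subsetP SG2.
rewrite /edgewise big1// => e _.
by rewrite /pattern (introT implyP (SG1 e)) (introT implyP (SG2 e)) mulr1.
Qed.

(** A subsample is contained in its parent graph, so each of the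
    [#|S1| + #|S2|] distinct edges has to be present in the parent. *)
Lemma pattern_mean_le c (S1 S2 : {set edge n}) :
  (forall e, q e <= c) -> [disjoint S1 & S2] ->
  \sum_x corr_CL_pmf w s x * edgewise (pattern S1 S2) x <= c ^+ (#|S1| + #|S2|).
Proof.
move=> qc dis; rewrite corr_CL_mean_edgewise.
have [s0 s1] := andP s01.
have -> : c ^+ (#|S1| + #|S2|) = \prod_(e in (S1 :|: S2)%SET) c.
  by rewrite prodr_const cardsU disjoint_setI0// cards0 subn0.
rewrite [leRHS]big_mkcond; apply: ler_prod => e _; rewrite /edge_mean /pattern.
have /andP[q0 q1] := edge_prob01 e; have qce := qc e.
have qs0 : 0 <= q e * s by rewrite mulr_ge0.
have qs1 : q e * s <= c by apply: le_trans qce; rewrite ler_piMr.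
rewrite !big_bool /= inE -/(q e).
have := disjointFr dis (x := e).
case: (e \in S1) => /= [-> //=|_]; last case: (e \in S2) => /=.
- by rewrite [X in _ <= X <= _](_ : _ = q e * s); [rewrite qs0|ring].
- by rewrite [X in _ <= X <= _](_ : _ = q e * s); [rewrite qs0|ring].
- by rewrite [X in _ <= X <= _](_ : _ = 1); [rewrite ler01 lexx|ring].
Qed.

End Expectation.

Arguments edgewise : simpl never.

(** * The union bound *)

Section UnionBound.
Variables (R : realType) (n : nat).

Lemma displaced_eq0 (sigma : {perm 'I_n}) :
  (displaced sigma == finset.set0) = (sigma == 1%g).
Proof.
apply/eqP/eqP => [/setP s0|->]; last first.
  by apply/setP => i; rewrite !inE perm1 eqxx.
by apply/permP => i; have := s0 i; rewrite !inE perm1 => /negbFE/eqP.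
Qed.

Lemma card_displaced (D : {set 'I_n}) :
  (#|[pred sigma : {perm 'I_n} | displaced sigma == D]| <= (#|D|)`!)%N.
Proof.
rewrite -card_perm; apply: subset_leq_card; apply/fintype.subsetP => sigma.
rewrite inE => /eqP <-; apply/fintype.subsetP => i.
by rewrite !inE.
Qed.

(** At most ['C(n, d) * d`! <= n ^ d] permutations displace exactly [d] points, so
    the sum is dominated by a geometric series of ratio [n%:R * c]. *)
Lemma sum_displaced_le (c : R) : 0 <= c -> n%:R * c <= 1 / 2 ->
  \sum_(sigma : {perm 'I_n} | sigma != 1%g) c ^+ #|displaced sigma| <=
  2 * (n%:R * c).
Proof.
move=> c0 nc; have nc0 : 0 <= n%:R * c by rewrite mulr_ge0.
apply: le_trans (@sum_geometric_le R _ n _); last by rewrite nc0 nc.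
rewrite (partition_big (@displaced n) (fun D => D != finset.set0)) /=; last first.
  by move=> sigma; rewrite displaced_eq0.
apply: (@le_trans _ _ (\sum_(D : {set 'I_n} | D != finset.set0)
    ((#|D|)`!%:R * c ^+ #|D|))).
  apply: ler_sum => D D0.
  apply: (@le_trans _ _ (\sum_(sigma | displaced sigma == D) c ^+ #|D|)).
    rewrite [leLHS]big_mkcond [leRHS]big_mkcond; apply: ler_sum => sigma _.
    case: (displaced sigma =P D) => [<-|_]; rewrite ?andbF// andbT.
    by case: ifP => // _; rewrite exprn_ge0.
  rewrite sumr_const -[leLHS]mulr_natl ler_wpM2r ?exprn_ge0// ler_nat.
  exact: card_displaced.
rewrite (partition_big (fun D : {set 'I_n} => inord #|D| : 'I_n.+1) predT)//=.
rewrite big_ord_recl big1 ?add0r; last first.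
  move=> D /andP[D0 /eqP/(congr1 val)].
  rewrite /= inordK ?ltnS; last by rewrite (leq_trans (max_card _))// card_ord.
  by move/eqP; rewrite cards_eq0 (negbTE D0).
apply: ler_sum => d _.
apply: (@le_trans _ _ (\sum_(D : {set 'I_n} | #|D| == d.+1)
    ((d.+1)`!%:R * c ^+ d.+1))).
  rewrite [leLHS]big_mkcond [leRHS]big_mkcond; apply: ler_sum => D _.
  have -> : (inord #|D| == lift ord0 d) = (#|D| == d.+1).
    rewrite -val_eqE /= inordK// ltnS (leq_trans (max_card _))//.
    by rewrite card_ord.
  case: (#|D| =P d.+1) => [->|_]; rewrite ?andbF// andbT.
  by case: ifP => // _; rewrite mulr_ge0// exprn_ge0.
rewrite sumr_const -[leLHS]mulr_natl mulrA -natrM exprMn -natrX.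
rewrite ler_wpM2r ?exprn_ge0// ler_nat.
have -> : #|[pred D : {set 'I_n} | #|D| == d.+1]| = 'C(n, d.+1).
  have := card_draws 'I_n d.+1; rewrite card_ord => <-.
  by apply: eq_card => D; rewrite !inE.
by rewrite bin_ffact ffact_le.
Qed.

(** The part of the conclusion of [kcore_witness] that does not depend on the random
    graphs: the union bound runs over these sets. *)
Definition witness k (sigma : {perm 'I_n}) (S : {set edge n}) :=
  [&& S \subset touching (displaced sigma),
      (k.-1 * #|displaced sigma| <= 6 * #|S|)%N
    & [disjoint S & edge_perm sigma @: S]%SET].

(** Split [(a / n) ^+ #|S|] into [a ^+ #|S| <= y ^+ d], where [d] is the number of
    displaced points, and [n ^- #|S|]. Summed over all subsets of the at most
    [d * n] touching edges, the second factor gives at most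
    [(1 + n^-1) ^+ (d * n) <= expR 1 ^+ d], so that no binomial coefficient
    has to be estimated. *)
Lemma sum_witness_le k sigma (a y : R) : (0 < n)%N -> 0 <= a -> 0 <= y ->
  (forall d m, (k.-1 * d <= 6 * m)%N -> a ^+ m <= y ^+ d) ->
  \sum_(S | witness k sigma S) (a / n%:R) ^+ #|S| <=
  (y * expR 1) ^+ #|displaced sigma|.
Proof.
move=> n0 a0 y0 ay; set d := #|displaced sigma|.
have n1 : 0 <= n%:R^-1 :> R by [].
apply: (@le_trans _ _ (\sum_(S : {set edge n}) y ^+ d *
    \prod_e (if e \in S then (e \in touching (displaced sigma))%:R / n%:R else 1))).
  rewrite big_mkcond; apply: ler_sum => S _.
  case: ifP => [/and3P[/fintype.subsetP Stouch dS _]|_]; last first.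
    rewrite mulr_ge0 ?exprn_ge0// prodr_ge0// => e _.
    by case: ifP => // _; rewrite mulr_ge0.
  rewrite -big_mkcond /= (eq_bigr (fun=> n%:R^-1)); last first.
    by move=> e /Stouch ->; rewrite mul1r.
  by rewrite prodr_const exprMn ler_wpM2r ?exprn_ge0// ay.
rewrite -mulr_sumr exprMn ler_wpM2l ?exprn_ge0// -bigA_distr.
rewrite (eq_bigr (fun e => if e \in touching (displaced sigma)
    then n%:R^-1 + 1 else 1)); last first.
  by move=> e _ /=; case: (e \in touching _); rewrite ?mul1r// mul0r add0r.
rewrite -big_mkcond /= prodr_const.
have le1 : n%:R^-1 + 1 <= expR (n%:R^-1) :> R by rewrite addrC expR_ge1Dx.
apply: (@le_trans _ _ (expR (n%:R^-1) ^+ #|touching (displaced sigma)|)).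
  by rewrite lerXn2r ?nnegrE ?expR_ge0// addr_ge0.
rewrite -!expRM_natl ler_expR mulr1 ler_pdivrMr ?ltr0n// -natrM ler_nat.
exact: card_touching.
Qed.

Variables (w : 'I_n -> R) (s : R).
Hypothesis w0 : forall i, 0 <= w i.
Hypothesis wW : forall i, w i <= Num.sqrt (\sum_j w j).
Hypothesis s01 : 0 <= s <= 1.

(** The union bound for fixed [n]. The first error term bounds the probability that
    some vertex has degree below [k] in the intersection of the two subsamples, the
    second that some [sigma != 1] has a witness. Here [p] bounds the edge
    probabilities, [a] stands for [n p^2], and [y] for the price that a
    witness pays per displaced point. *)
Lemma exact_recovery_prob_ge k (est : graph n -> graph n -> matching n)
    (t p a y : R) :
  kcore_estimator k est -> (0 < n)%N -> 0 < t <= 1 ->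
  (forall e, chung_lu_edge_prob w e <= p) -> p ^+ 2 <= a / n%:R ->
  0 <= y -> (forall d m, (k.-1 * d <= 6 * m)%N -> a ^+ m <= y ^+ d) ->
  n%:R * (y * expR 1) <= 1 / 2 ->
  1 - (t ^- k * (\sum_i expR (1 - (1 - t) * (w i * s ^+ 2)))
       + 2 * (n%:R * (y * expR 1)))
  <= corr_CL_prob w s (exact_recovery est) <= 1.
Proof.
move=> kest n0 /andP[t0 t1] qp pa y0 ay ny.
(* [X] counts the witnesses of failure, low degrees with weight at least 1. *)
pose X x := \sum_i t ^- k * edgewise (tilt t i) x +
  \sum_(sigma : {perm 'I_n} | sigma != 1%g) \sum_(S | witness k sigma S)
    edgewise (pattern R S (edge_perm sigma @: S)%SET) x.
have tilt0 (i : 'I_n) x : 0 <= t ^- k * edgewise (tilt t i) x.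
  rewrite mulr_ge0 ?invr_ge0 ?exprn_ge0 ?(ltW t0)//.
  case: x => -[[G G1] G2] pi; rewrite /edgewise prodr_ge0// => e _.
  by rewrite /tilt; case: ifP => // _; rewrite ltW.
have pat0 (S S' : {set edge n}) x : 0 <= edgewise (pattern R S S') x.
  case: x => -[[G G1] G2] pi; rewrite /edgewise prodr_ge0// => e _.
  by rewrite mulr_ge0.
have low0 (P : pred 'I_n) x :
    0 <= \sum_(i | P i) t ^- k * edgewise (tilt t i) x.
  by apply: sumr_ge0 => i _; exact: tilt0.
have wrong0 (P : pred {perm 'I_n}) (Q : {perm 'I_n} -> pred {set edge n}) x :
    0 <= \sum_(sigma | P sigma) \sum_(S | Q sigma S)
      edgewise (pattern R S (edge_perm sigma @: S)%SET) x.
  by apply: sumr_ge0 => sigma _; apply: sumr_ge0 => S _; exact: pat0.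
have X0 x : 0 <= X x by rewrite addr_ge0.
have X1 x : ~~ exact_recovery est x -> 1 <= X x.
  case: x => -[[G G1] G2] pi /negP bad; rewrite leNgt; apply/negP => Xlt1.
  apply: bad; apply: (kcore_estimator_exact pi kest) => [i|sigma sigma1].
    rewrite leqNgt; apply/negP => deg; move: Xlt1; apply/negP; rewrite -leNgt.
    rewrite /X (bigD1 i)//= -addrA ler_wpDr ?addr_ge0//.
    rewrite edgewise_tilt mulrC ler_pdivlMr ?exprn_gt0// mul1r.
    by rewrite ler_wiXn2l ?(ltW t0) ?(ltnW deg)//.
  apply/existsP; rewrite -[X in is_true X]negbK negb_exists.
  apply/negP => /forallP core.
  have [|S [St dS dis SG1 SG2]] := @kcore_witness n k sigma G1 G2.
    by move=> i; have := core i; rewrite -leqNgt.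
  move: Xlt1; apply/negP; rewrite -leNgt /X ler_wpDl//.
  rewrite (bigD1 sigma)//= (bigD1 S) /=; last by rewrite /witness St dS dis.
  rewrite -addrA ler_wpDr ?edgewise_pattern// addr_ge0//.
  by apply: sumr_ge0 => S' _; exact: pat0.
have /andP[lo ->] := corr_CL_prob_le w0 wW s01 X0 X1; rewrite andbT.
apply: le_trans lo; rewrite lerD2l lerN2.
under eq_bigr do rewrite mulrDr.
rewrite big_split /= lerD//.
  under eq_bigr do rewrite mulr_sumr.
  rewrite exchange_big /= mulr_sumr; apply: ler_sum => i _.
  under eq_bigr do rewrite mulrCA.
  rewrite -mulr_sumr ler_wpM2l ?invr_ge0 ?exprn_ge0 ?(ltW t0)//.
  by apply: (tilt_mean_le w0 wW s01); rewrite (ltW t0) t1.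
have a0 : 0 <= a.
  by move: (le_trans (sqr_ge0 p) pa); rewrite pmulr_lge0// invr_gt0 ltr0n.
apply: le_trans (sum_displaced_le _ ny); last by rewrite mulr_ge0 ?expR_ge0.
under eq_bigr do rewrite mulr_sumr.
rewrite exchange_big /=; apply: ler_sum => sigma _.
apply: le_trans (sum_witness_le sigma n0 a0 y0 ay).
under eq_bigr do rewrite mulr_sumr.
rewrite exchange_big /=; apply: ler_sum => S /and3P[_ _ dis].
apply: le_trans (pattern_mean_le w0 wW s01 qp dis) _.
rewrite card_imset; last exact: edge_perm_inj.
rewrite addnn -muln2 mulnC exprM lerXn2r// nnegrE ?sqr_ge0//.
by rewrite mulr_ge0.
Qed.

End UnionBound.

(** * Asymptotics *)

Local Open Scope classical_set_scope.
Local Open Scope ring_scope.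

Lemma cvg_natr_powRN (R : realType) (r : R) : 0 < r ->
  n%:R `^ (- r) @[n --> \oo] --> (0 : R).
Proof.
move=> r0.
have cvgy : r * ln (n%:R : R) @[n --> \oo] --> +oo.
  apply/cvgryPge => A; near=> n.
  have An : expR (A / r) <= n%:R :> R.
    by near: n; exact: (cvgry_ge cvgr_idn).
  have n0 : 0 < n%:R :> R := lt_le_trans (expR_gt0 _) An.
  by rewrite mulrC -ler_pdivrMr// -ler_expR lnK.
apply: cvg_trans (cvg_comp _ _ cvgy (@cvgr_expR R)).
apply: near_eq_cvg; near=> n => /=.
have n0 : n%:R != 0 :> R by rewrite pnatr_eq0 -lt0n; near: n; exists 1%N.
by rewrite /powR (negbTE n0) mulNr.
Unshelve. all: by end_near. Qed.

Theorem corollary2 (R : realType)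
    (w : forall n : nat, 'I_n -> R) (s : nat -> R) (alpha : R) (k : nat)
    (est : forall n : nat, graph n -> graph n -> matching n) :
  (forall (n : nat) (i : 'I_n), 0 <= w n i) ->
  (forall (n : nat) (i : 'I_n), w n i <= Num.sqrt (\sum_(j < n) w n j)) ->
  (forall n : nat, 0 <= s n <= 1) ->
  1 / 2 < alpha <= 1 ->
  (exists2 delta : nat -> R, delta n @[n --> \oo] --> (0 : R) &
    forall (n : nat) (i : 'I_n),
      w n i <= n%:R `^ (- alpha / 2 + delta n)
               * Num.sqrt (\sum_(j < n) w n j)) ->
  (0 < k)%N ->
  12 / (2 * alpha - 1) < k%:R ->
  (exists2 eps : R, 0 < eps &
    forall (n : nat) (i : 'I_n), (1 + eps) * ln n%:R <= w n i * s n ^+ 2) ->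
  (forall n : nat, kcore_estimator k (est n)) ->
  corr_CL_prob (w n) (s n) (exact_recovery (est n)) @[n --> \oo] --> (1 : R).
Proof.
move=> w0 wW s01 /andP[alpha_gt alpha_le1] [delta delta0 w_le] k0 k_gt.
move=> [eps eps0 w_ge] kest.
have a1 : 0 < 2 * alpha - 1 by lra.
have {}k_gt : 12 < k%:R * (2 * alpha - 1) by rewrite -ltr_pdivrMr.
have kE : (k.-1)%:R = k%:R - 1 :> R by rewrite -[in RHS](prednK k0) -natr1 addrK.
(* [eta] absorbs [delta n] for large [n]. It is small enough to keep
   [beta * (k - 1) >= 9]; this is what makes a witness for [d] displaced points,
   of size at least [(k - 1) * d / 6], cost at least [3 / 2 * d] powers of [n]. *)
pose eta : R := (2 * alpha - 1) / 24.
have eta0 : 0 < eta by rewrite divr_gt0.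
pose beta : R := 2 * alpha - 1 - 4 * eta.
have beta_k : 9 <= beta * (k.-1)%:R by rewrite kE /beta /eta; nra.
have beta0 : 0 < beta by rewrite /beta /eta; lra.
(* With this [t], the tilt costs only half of the margin [eps]. *)
pose t : R := eps / (2 * (1 + eps)).
have t01 : 0 < t <= 1.
  rewrite divr_gt0 ?mulr_gt0 ?addr_gt0//= ler_pdivrMr ?mulr_gt0 ?addr_gt0//.
  by lra.
have tE : (1 - t) * (1 + eps) = 1 + eps / 2.
  by rewrite /t; field; rewrite gt_eqF// addr_gt0.
pose err (n : nat) : R := t ^- k * expR 1 * n%:R `^ (- (eps / 2)) +
  2 * expR 1 * n%:R `^ (- (1 / 2)).
have err0 : err n @[n --> \oo] --> (0 : R).
  rewrite [X in _ --> X](_ : _ = t ^- k * expR 1 * 0 + 2 * expR 1 * 0);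
    last by rewrite !mulr0 addr0.
  by apply: cvgD; (apply: cvgM; [exact: cvg_cst|apply: cvg_natr_powRN]);
    rewrite divr_gt0.
have half0 : expR 1 * n%:R `^ (- (1 / 2)) @[n --> \oo] --> (0 : R).
  rewrite -[X in _ --> X](mulr0 (expR 1)).
  by apply: cvgM; [exact: cvg_cst|apply: cvg_natr_powRN; rewrite divr_gt0].
apply: (@squeeze_cvgr _ _ _ _ (fun n => 1 - err n) (fun=> 1)); last 2 first.
- by rewrite -[X in _ --> X]subr0; apply: cvgB => //; exact: cvg_cst.
- exact: cvg_cst.
near=> n.
have n0 : (0 < n)%N by near: n; exists 1%N.
have nR0 : 0 < n%:R :> R by rewrite ltr0n.
have nR1 : 1 <= n%:R :> R by rewrite ler1n.
have nRn0 : n%:R != 0 :> R by rewrite gt_eqF.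
have delta_eta : `|delta n| <= eta.
  near: n; exact: (cvgr0_norm_le _ delta0).
pose c : R := n%:R `^ (- alpha / 2 + eta).
have w_c (i : 'I_n) : w n i <= c * Num.sqrt (\sum_(j < n) w n j).
  apply: le_trans (w_le n i) _; rewrite ler_wpM2r ?sqrtr_ge0// ler_powR//.
  by rewrite lerD2l; apply: le_trans (ler_norm _) delta_eta.
have q_c := edge_prob_le (w0 n) (w_c).
pose y : R := n%:R `^ (- (3 / 2)).
have ny : n%:R * (y * expR 1) = expR 1 * n%:R `^ (- (1 / 2)).
  rewrite /y mulrA -{1}(powRr1 (ltW nR0)) -powRD ?nRn0 ?implybT// mulrC.
  by congr (_ * _ `^ _); lra.
have /andP[lo ->] : 1 - (t ^- k *
    (\sum_i expR (1 - (1 - t) * (w n i * s n ^+ 2))) +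
    2 * (n%:R * (y * expR 1))) <=
    corr_CL_prob (w n) (s n) (exact_recovery (est n)) <= 1.
  apply: (@exact_recovery_prob_ge R n _ _ (w0 n) (wW n) (s01 n) k (est n) t
    (c ^+ 2) (n%:R `^ (- beta)) y (kest n) n0 t01 q_c).
  - rewrite -exprM /c -powR_mulrn ?powR_ge0// -powRrM.
    rewrite -(powR_inv1 (ltW nR0)) -powRD ?nRn0 ?implybT//.
    by rewrite ler_powR// /beta; lra.
  - exact: powR_ge0.
  - move=> d m dm; rewrite -!powR_mulrn ?powR_ge0// -!powRrM ler_powR//.
    have dmR : (k.-1)%:R * d%:R <= 6 * m%:R :> R by rewrite -!natrM ler_nat.
    have d0 : 0 <= d%:R :> R by [].
    have : beta * ((k.-1)%:R * d%:R) <= beta * (6 * m%:R) by rewrite ler_pM2l.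
    have : 9 * d%:R <= beta * (k.-1)%:R * d%:R by rewrite ler_wpM2r.
    lra.
  - by rewrite ny; near: n; exact: (cvgr_le _ half0).
rewrite andbT; apply: le_trans lo; rewrite lerD2l lerN2 ny /err -!mulrA.
rewrite lerD2r ler_wpM2l ?invr_ge0 ?exprn_ge0 ?(ltW (andP t01).1)//.
apply: (@le_trans _ _ (\sum_(i < n) expR (1 - (1 + eps / 2) * ln n%:R))).
  apply: ler_sum => i _; rewrite ler_expR lerD2l lerN2 -tE -mulrA ler_wpM2l//.
  by have := andP t01; lra.
have nE : n%:R = expR (ln n%:R) :> R by rewrite lnK.
rewrite sumr_const card_ord -[leLHS]mulr_natl [X in X * _]nE -expRD.
rewrite /powR (negbTE nRn0) -expRD ler_expR; lra.
Unshelve. all: by end_near. Qed.
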